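(* Let $r\ge2$ be even and $\alpha=\alpha_{1,r}=-2/(r-1)$. Let $\eta=(\eta_1,\dots,\eta_m)$ be a strictly decreasing partition and $\mu=(\mu_1,\dots,\mu_{N-m})$ a partition (parts allowed to be zero), and let $\lambda=(\eta_1,\dots,\eta_m,\mu_1,\dots,\mu_{N-m})$ be their concatenation. Assume $\lambda$ is weakly $(1,r,N|m)$-admissible. Then the non-symmetric Jack polynomial $E_\lambda(x;\alpha_{1,r})$ is the unique polynomial $E$ satisfying (1) $E=x^\lambda+\sum_{\gamma\prec\lambda}c_{\lambda,\gamma}x^\gamma$ with $c_{\lambda,\gamma}\in\mathbb{C}$; (2) $\xi_iE=\bar\lambda_iE$ for all $1\le i\le N$, where $\xi_i$ and $\bar\lambda_i$ are taken at $\alpha=\alpha_{1,r}$.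
   Context: $x=(x_1,\dots,x_N)$; $K_{i,j}$ exchanges $x_i,x_j$. Compositions $\gamma\in\mathbb{Z}_{\ge0}^N$, $x^\gamma=\prod x_i^{\gamma_i}$, $\gamma^+$ decreasing rearrangement. Partitions of equal size compared by dominance ($\lambda\ge\mu$ iff all partial sums of $\lambda$ are $\ge$ those of $\mu$). For compositions of equal degree, $\lambda\succ\gamma$ iff $\lambda\ne\gamma$ and either $\lambda^+>\gamma^+$, or $\lambda^+=\gamma^+$ and $\sum_{i\le k}\lambda_i\ge\sum_{i\le k}\gamma_i$ for all $k$. Cherednik operators $\xi_j=\alpha x_j\partial_{x_j}+\sum_{i<j}\frac{x_j}{x_j-x_i}(1-K_{i,j})+\sum_{i>j}\frac{x_i}{x_j-x_i}(1-K_{i,j})-(j-1)$; $\bar\lambda_j=\alpha\lambda_j-\#\{i<j:\lambda_i\ge\lambda_j\}-\#\{i>j:\lambda_i>\lambda_j\}$. For $\alpha$ formal, $E_\lambda(x;\alpha)$ is the unique polynomial $x^\lambda+\sum_{\gamma\prec\lambda}c_{\lambda,\gamma}x^\gamma$ (coefficients rational in $\alpha$) with $\xi_jE_\lambda=\bar\lambda_jE_\lambda$ for all $j$; under the hypotheses it has no pole at $\alpha_{1,r}$ and $E_\lambda(x;\alpha_{1,r})$ is its value there. For a composition $\lambda$ and $0\le m\le N$, $\varphi_m(\lambda)$ is the superpartition $\Lambda$ with $\Lambda^*=(\lambda_1,\dots,\lambda_N)^+$ and $\Lambda^\circledast=(\lambda_1+1,\dots,\lambda_m+1,\lambda_{m+1},\dots,\lambda_N)^+$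 (partitions, padded with zeros). $\lambda$ is weakly $(1,r,N|m)$-admissible if $\Lambda=\varphi_m(\lambda)$ satisfies $\Lambda^\circledast_i-\Lambda^*_{i+1}\ge r$ for all $1\le i\le N-1$. *)

(* Defs.v *)
From HB Require Import structures.
From mathcomp Require Import all_boot all_order all_fingroup all_algebra.
From mathcomp Require Import complex.
From mathcomp Require Import reals.
From mathcomp Require Import mpoly.

Set Implicit Arguments.
Unset Strict Implicit.
Unset Printing Implicit Defensive.

Import GRing.Theory.
Local Open Scope ring_scope.

(* Compositions with N parts are the exponent vectors 'X_{1..N}.  Indices in
   'I_N start at 0, so the (j - 1) of the Cherednik operator becomes j. *)

Section Compositions.
Variable N : nat.
Implicit Types l g : 'X_{1..N}.

Definition decr_rearr l : 'X_{1..N} := Multinom (sort_tuple geq l).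

Definition dominates l g : bool :=
  [forall k : 'I_N, (\sum_(i < N | i <= k) g i <= \sum_(i < N | i <= k) l i)%N].

Definition comp_gt l g : bool :=
  [&& mdeg l == mdeg g, l != g &
      (decr_rearr l != decr_rearr g) && dominates (decr_rearr l) (decr_rearr g)
   || (decr_rearr l == decr_rearr g) && dominates l g].

(* A superpartition is given by its pair of partitions
   (Lambda^*, Lambda^\circledast). *)
Definition superpart (m : nat) l : 'X_{1..N} * 'X_{1..N} :=
  (decr_rearr l, decr_rearr [multinom (l i + (i < m))%N | i < N]).

Definition weakly_admissible (r m : nat) l : Prop :=
  forall i j : 'I_N, j = i.+1 :> nat ->
    (r%:Z <= ((superpart m l).2 i)%:Z - ((superpart m l).1 j)%:Z)%R.

End Compositions.

Section Cherednik.
Variables (F : fieldType) (N : nat) (a : F).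
Implicit Types (l : 'X_{1..N}) (j : 'I_N) (p E : {mpoly F[N]}).

Local Notation "x %:F" := (@FracField.tofrac {mpoly F[N]} x).

(* The Cherednik operators have rational-function coefficients; they are
   valued in the field of rational functions F(x_1, ..., x_N). *)
Definition cherednik j p : {fraction {mpoly F[N]}} :=
  (a *: ('X_j * p^`M(j)))%:F
  + \sum_(i < N | (i < j)%N)
      ('X_j)%:F / ('X_j - 'X_i)%:F * (p - msym (tperm i j) p)%:F
  + \sum_(i < N | (j < i)%N)
      ('X_i)%:F / ('X_j - 'X_i)%:F * (p - msym (tperm i j) p)%:F
  - (j%:R *: p)%:F.

Definition eigenval l j : F :=
  a * (l j)%:R
  - #|[set i : 'I_N | (i < j)%N && (l j <= l i)%N]|%:R
  - #|[set i : 'I_N | (j < i)%N && (l j < l i)%N]|%:R.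

(* Every composition g with l > g has degree mdeg l, hence occurs in the
   finite index type 'X_{1..N < (mdeg l).+1}. *)
Definition unitriangular l E : Prop :=
  exists c : 'X_{1..N} -> F,
    E = 'X_[l] + \sum_(g : 'X_{1..N < (mdeg l).+1} | comp_gt l g) c g *: 'X_[g].

Definition cherednik_eigen l E : Prop :=
  forall j, cherednik j E = (eigenval l j *: E)%:F.

End Cherednik.

Section NonSymmetricJack.
Variables (F : fieldType) (N : nat).

Definition is_nsJack (a : F) (l : 'X_{1..N}) (E : {mpoly F[N]}) : Prop :=
  unitriangular l E /\ cherednik_eigen a l E.

End NonSymmetricJack.

Section Specialization.
Variables (K : fieldType) (N : nat).

Local Notation "x %:F" := (@FracField.tofrac {poly K} x).

Definition formal_alpha : {fraction {poly K}} := 'X%:F.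

(* The rational function f has no pole at a, and its value there is v. *)
Definition value_at (a : K) (f : {fraction {poly K}}) (v : K) : Prop :=
  exists p q : {poly K}, [/\ q.[a] != 0, f = p%:F / q%:F & v = p.[a] / q.[a]].

(* E is E_l(x; a): the value at alpha = a, coefficient by coefficient, of the
   polynomial E_l(x; alpha) characterized over the field K(alpha). *)
Definition nsJack_at (a : K) (l : 'X_{1..N}) (E : {mpoly K[N]}) : Prop :=
  exists Ea : {mpoly {fraction {poly K}}[N]},
    unique (is_nsJack formal_alpha l) Ea
    /\ forall g : 'X_{1..N}, value_at a Ea@_g E@_g.

End Specialization.

Definition alpha_1 (K : fieldType) (r : nat) : K := - 2 / (r%:R - 1).

Definition concat_comp (m n : nat) (eta : m.-tuple nat) (mu : n.-tuple nat) :
  'X_{1..m + n} := Multinom (cat_tuple eta mu).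

(* Main.v *)
(** The Cherednik operators xi_j preserve polynomials and are triangular on
    monomials for the order on compositions, with diagonal entries the
    eigenvalues of the statement. Hence, whenever the spectrum of [l] differs
    from that of every other composition, a maximal monomial of a joint
    eigenvector with the spectrum of [l] must be x^l; this yields uniqueness
    and unitriangularity at once. Over K[alpha] a nonzero joint eigenvector is
    produced from 1 by the intertwiners of the affine Hecke algebra (adjacent
    transpositions with cleared denominators, and the raising operator
    x_N f(x_N, x_1, ..., x_{N-1})). Dividing it by alpha - a as often as
    possible and specialising gives a nonzero joint eigenvector at a; its
    x^l-coefficient cannot vanish if the spectrum of [l] is still separated at
    a, so normalising by that coefficient creates no pole.

    At a = -2/(r-1) the spectrum of [g] amounts to the numbers
    2 g_j + (r-1) rank_j, where rank_j is the position of j in the decreasing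
    rearrangement. Weak admissibility says that consecutive parts of [l] differ
    by at least r-1, and by at least r after an index >= m. If [g] has the same
    numbers, two consecutive ranks of [g] can be inverted in [l] only when the
    gap is exactly r-1 and the parts of [g] are equal; then both indices lie
    in the strictly decreasing block eta and the tie-break is violated. So the
    ranks of [g] and [l] agree, and [g] = [l]. *)

From HB Require Import structures.
Require Import Defs.
From mathcomp Require Import all_boot all_order all_fingroup all_algebra.
From mathcomp Require Import complex.
From mathcomp Require Import reals.
From mathcomp Require Import mpoly.
From mathcomp Require Import zify ring.

Set Implicit Arguments.
Unset Strict Implicit.
Unset Printing Implicit Defensive.

Import GRing.Theory.
Local Open Scope ring_scope.

(** * Ranks of parts and the order on compositions *)

Section Rank.
Variable N : nat.
Implicit Types (l g nu : 'X_{1..N}) (i j k : 'I_N).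

(** The strict total order from larger to smaller parts, ties going to the smaller index; [rank] is
    the position in it, counted from 0. *)
Definition before l i j : bool := ((l j < l i) || (l i == l j) && (i < j))%N.

Definition rank l j : nat := #|[set i | before l i j]|.

Lemma before_irr l i : before l i i = false.
Proof. by rewrite /before !ltnn andbF. Qed.

Lemma before_trans l : transitive (before l).
Proof. by move=> j i k; rewrite /before; lia. Qed.

Lemma before_total l i j : i != j -> before l i j || before l j i.
Proof. by rewrite /before -val_eqE /=; lia. Qed.

Lemma before_rank l i j : before l i j -> (rank l i < rank l j)%N.
Proof.
move=> ltij; apply: proper_card; apply/properP; split.
  by apply/subsetP=> k; rewrite !inE => /before_trans; apply.
by exists i; rewrite !inE ?before_irr.
Qed.

Lemma rank_inj l : injective (rank l).
Proof.
move=> i j eqr; apply/eqP; case: (boolP (i == j)) => // /(before_total l).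
by case/orP=> /before_rank; rewrite eqr ltnn.
Qed.

Lemma rank_before l i j : (rank l i < rank l j)%N = before l i j.
Proof.
apply/idP/idP => [ltr|]; last exact: before_rank.
have /(before_total l)/orP[//|/before_rank] : i != j.
  by apply: contraL ltr => /eqP->; rewrite ltnn.
by move: ltr; lia.
Qed.

Lemma rank_ltN l j : (rank l j < N)%N.
Proof.
rewrite -[X in (_ < X)%N]card_ord -cardsT; apply: proper_card.
by apply/properP; split; [exact: subsetT | exists j; rewrite ?inE ?before_irr].
Qed.

Lemma rank_perm l g (s : 'S_N) :
  (forall i j, before g (s i) (s j) = before l i j) ->
  forall j, rank g (s j) = rank l j.
Proof.
move=> sP j; rewrite /rank -[RHS](card_imset _ (@perm_inj _ s)).
apply: eq_card => i; rewrite !inE -[ i](permKV s) sP.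
by rewrite mem_imset ?inE //; exact: perm_inj.
Qed.

Definition rank_ord l j : 'I_N := Ordinal (rank_ltN l j).

Lemma rank_ord_inj l : injective (rank_ord l).
Proof. by move=> i j /(congr1 val) /= /rank_inj. Qed.

Lemma rank_surj l s : (s < N)%N -> exists j, rank l j = s.
Proof.
move=> ltsN; exists (invF (@rank_ord_inj l) (Ordinal ltsN)).
by rewrite -[LHS]/(val (rank_ord l _)) f_invF.
Qed.

(** The order of [l] also sorts any [nu] that decreases weakly along it. With [nu] the composition
    whose first [m] parts are raised, both halves of a superpartition are read at the ranks of
    [l]. *)
Lemma decr_rearr_rank l nu j k :
  (forall i i', before l i i' -> (nu i' <= nu i)%N) ->
  rank l j = k -> decr_rearr nu k = nu j.
Proof.
move=> cmp rk; pose s := perm (@rank_ord_inj l).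
pose t := [tuple nu ((s^-1)%g i) | i < N].
have st : sorted geq t.
  apply/(sortedP 0%N) => i; rewrite size_tuple => ltiN.
  rewrite -[ i]/(val (Ordinal (ltnW ltiN))) -[i.+1]/(val (Ordinal ltiN)).
  rewrite -!tnth_nth !tnth_mktuple /=; apply: cmp.
  rewrite -rank_before -[rank _ _]/(val (rank_ord l _)).
  rewrite -[X in (_ < X)%N]/(val (rank_ord l _)).
  by rewrite -[rank_ord _ _](permE (@rank_ord_inj l))
    -[rank_ord _ ((s^-1)%g (Ordinal ltiN))](permE (@rank_ord_inj l)) !permKV /=.
have pt : perm_eq nu t.
  apply/tuple_permP; exists s; rewrite /t.
  by congr tval; apply: eq_from_tnth => i; rewrite !tnth_mktuple permK mnm_tnth.
have -> : decr_rearr nu = [multinom t].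
  apply/val_inj/val_inj => /=.
  apply: (sorted_eq (leT := geq)).
  - by move=> a b c /=; lia.
  - by move=> a b /=; lia.
  - by apply: sort_sorted => a b /=; lia.
  - exact: st.
  - by rewrite perm_sort.
rewrite mnm_tnth tnth_mktuple; congr (nu _).
by apply: (canLR (permK s)); rewrite permE; apply/val_inj; rewrite /= rk.
Qed.

Lemma decr_rearrE l j : decr_rearr l (rank_ord l j) = l j.
Proof. by apply: (@decr_rearr_rank l) => // a b; rewrite /before; lia. Qed.

Lemma decr_rearr_sorted l i j : (i <= j)%N -> (decr_rearr l j <= decr_rearr l i)%N.
Proof.
have [i' <-] : exists i', rank_ord l i' = i.
  by have [i' e] := rank_surj l (ltn_ord i); exists i'; apply/val_inj.
have [j' <-] : exists j', rank_ord l j' = j.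
  by have [j' e] := rank_surj l (ltn_ord j); exists j'; apply/val_inj.
rewrite !decr_rearrE /= leq_eqVlt => /orP[/eqP/rank_inj -> //|].
by rewrite rank_before /before; lia.
Qed.

Lemma decr_rearr_perm l (s : 'S_N) : decr_rearr [multinom l (s i) | i < N] = decr_rearr l.
Proof.
apply/val_inj/val_inj => /=; apply/perm_sortP.
- by move=> a b /=; lia.
- by move=> a b c /=; lia.
- by move=> a b /=; lia.
- apply/tuple_permP.
  by exists s; congr tval; apply: eq_from_tnth => i; rewrite !tnth_mktuple mnm_tnth.
Qed.

(** Truncated subtraction makes this a symmetric convex function of the parts; it tests dominance
    without sorting. *)
Definition excess (t : nat) l : nat := (\sum_i (l i - t))%N.

Lemma excess_decr_rearr t l : excess t (decr_rearr l) = excess t l.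
Proof.
rewrite /excess (reindex_inj (@rank_ord_inj l)) /=.
by apply: eq_bigr => i _; rewrite decr_rearrE.
Qed.

(* The sum of the k largest parts of l is the minimum over t of
   k t + excess t l. *)
Lemma dominates_decr_rearr l g :
  (forall t, excess t g <= excess t l)%N ->
  dominates (decr_rearr l) (decr_rearr g).
Proof.
move=> le_ex; apply/forallP => k.
(* The minimum is attained at this [t]: parts up to position [k] are at least [t], later ones have
   no excess. *)
set t := decr_rearr l k.
have -> : (\sum_(i < N | i <= k) decr_rearr l i =
           \sum_(i < N | i <= k) t + excess t l)%N.
  rewrite -excess_decr_rearr /excess [X in (_ + X)%N](bigID (fun i : 'I_N => i <= k)%N) /=.
  rewrite [X in (_ + (_ + X))%N]big1 ?addn0.
    rewrite -big_split /=; apply: eq_bigr => i ik.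
    by have := decr_rearr_sorted l ik; rewrite -/t; lia.
  by move=> i; rewrite -ltnNge => /ltnW/(decr_rearr_sorted l); rewrite -/t; lia.
apply: leq_trans (leq_add (leqnn _) (le_ex t)).
rewrite -(excess_decr_rearr t g) /excess [X in (_ + X)%N](bigID (fun i : 'I_N => i <= k)%N) /=.
rewrite addnA -big_split /=.
by apply: leq_trans (leq_addr _ _); apply: leq_sum => i _; lia.
Qed.

Lemma dominates_trans l g nu : dominates l g -> dominates g nu -> dominates l nu.
Proof.
move=> /forallP a /forallP b; apply/forallP => k.
exact: leq_trans (b k) (a k).
Qed.

Lemma dominates_anti l g : dominates l g -> dominates g l -> l = g.
Proof.
move=> /forallP a /forallP b.
have eqs k : (\sum_(i < N | i <= k) g i = \sum_(i < N | i <= k) l i)%N.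
  by apply/eqP; rewrite eqn_leq a b.
suff H s : forall i, val i = s -> l i = g i by apply/mnmP => i; exact: (H i).
elim/ltn_ind: s => s IH i eqi.
have := eqs i; rewrite (bigD1 i) //= [X in _ = X](bigD1 i) //=.
rewrite (eq_bigr l) => [/addIn //|k /andP[ki nki]].
by symmetry; apply: (IH k) => //; move: ki nki; rewrite -eqi -val_eqE /=; lia.
Qed.

Lemma comp_gt_irr l : comp_gt l l = false.
Proof. by rewrite /comp_gt !eqxx. Qed.

Lemma comp_gt_trans l g nu : comp_gt l g -> comp_gt g nu -> comp_gt l nu.
Proof.
move=> /and3P[/eqP d1 n1 h1] /and3P[/eqP d2 n2 h2].
have n3 : l != nu.
  apply: contraNneq n1 => e; subst nu.
  case/orP: h1 => /andP[e1 h1]; case/orP: h2 => /andP[e2 h2].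
  - by rewrite (dominates_anti h1 h2) eqxx in e1.
  - by rewrite eq_sym e2 in e1.
  - by rewrite eq_sym e1 in e2.
  - by rewrite (dominates_anti h1 h2).
apply/and3P; split; rewrite ?d1 ?d2 //.
case/orP: h1 => /andP[e1 h1]; case/orP: h2 => /andP[e2 h2].
- rewrite (dominates_trans h1 h2) andbT; apply/orP; left.
  by apply: contraNneq e1 => e; rewrite e in h1 *; rewrite (dominates_anti h1 h2).
- by rewrite -(eqP e2) e1 h1.
- by rewrite (eqP e1) e2 h2.
- by rewrite (eqP e1) e2 (dominates_trans h1 h2) orbT.
Qed.

Lemma big_two (F : 'I_N -> nat) i j : i != j ->
  (\sum_k F k = F i + F j + \sum_(k | (k != i) && (k != j)) F k)%N.
Proof. by move=> nij; rewrite (bigD1 i) //= (bigD1 j) 1?eq_sym //= addnA. Qed.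

Lemma mdeg_two l g i j : i != j ->
  (forall k, k != i -> k != j -> g k = l k) ->
  (g i + g j = l i + l j)%N -> mdeg l = mdeg g.
Proof.
move=> nij gl gs; rewrite !mdegE !(big_two _ nij) gs.
by congr (_ + _)%N; apply: eq_bigr => k /andP[ki kj]; rewrite gl.
Qed.

(** By convexity no [excess] grows when two parts approach each other; at [t] equal to the larger
    new part it drops strictly, so the rearrangements differ. *)
Lemma comp_gt_between l g i j : i != j ->
  (forall k, k != i -> k != j -> g k = l k) ->
  (g i + g j = l i + l j)%N ->
  (maxn (g i) (g j) < maxn (l i) (l j))%N -> comp_gt l g.
Proof.
move=> nij gl gs gm.
have ex t h : excess t h = ((h i - t) + (h j - t) +
     \sum_(k | (k != i) && (k != j)) (h k - t))%N.
  exact: big_two.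
have rest t : (\sum_(k | (k != i) && (k != j)) (g k - t) =
               \sum_(k | (k != i) && (k != j)) (l k - t))%N.
  by apply: eq_bigr => k /andP[ki kj]; rewrite gl.
have nd : decr_rearr l != decr_rearr g.
  apply/eqP => e; have := excess_decr_rearr (maxn (g i) (g j)) l.
  rewrite e excess_decr_rearr !ex rest; lia.
apply/and3P; split.
- by rewrite (mdeg_two nij gl gs).
- by apply: contraNneq nd => ->.
- rewrite nd dominates_decr_rearr // => t; rewrite !ex rest leq_add2r; lia.
Qed.

(** The rearrangements agree, so partial sums decide; they differ only between [i] and [j], where
    [l] already counts the larger part. *)
Lemma comp_gt_swap l g i j : (i < j)%N -> (l j < l i)%N ->
  (forall k, g k = l (tperm i j k)) -> comp_gt l g.
Proof.
move=> ij lij gE.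
have nij : i != j by rewrite -val_eqE /=; lia.
have gl k : k != i -> k != j -> g k = l k.
  by move=> ki kj; rewrite gE tpermD // eq_sym.
have gi : g i = l j by rewrite gE tpermL.
have gj : g j = l i by rewrite gE tpermR.
apply/and3P; split.
- by rewrite (mdeg_two nij gl) // gi gj addnC.
- by apply/eqP => e; move: lij; rewrite -{1}gi e ltnn.
- have -> : g = [multinom l (tperm i j k) | k < N] by apply/mnmP=> k; rewrite mnmE.
  rewrite decr_rearr_perm eqxx /=.
  apply/forallP => k; rewrite big_mkcond [X in (_ <= X)%N]big_mkcond /=.
  rewrite !(big_two _ nij) !mnmE tpermL tpermR.
  rewrite [X in (_ + X <= _)%N](_ : _ =
    (\sum_(a | (a != i) && (a != j)) if a <= k then l a else 0)%N); last first.
    by apply: eq_bigr => a /andP[ai aj]; rewrite mnmE -gE gl.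
  rewrite leq_add2r; case: (leqP i k) => ik; case: (leqP j k) => jk; lia.
Qed.

End Rank.

(** * Cherednik operators on polynomials and adjacent transpositions *)

Section Operators.
Variables (F : idomainType) (N : nat).
Implicit Types (a : F) (i j k : 'I_N) (g h : 'X_{1..N}) (p q : {mpoly F[N]}).

Definition mset2 g i j (u v : nat) : 'X_{1..N} :=
  [multinom if k == i then u else if k == j then v else g k | k < N].

(** The quotient on a monomial is a finite geometric sum, so no division occurs and coefficients may
    lie in a domain such as K[alpha]. *)
Definition divdiffX i j g : {mpoly F[N]} :=
  if (g i <= g j)%N
  then \sum_(t < g j - g i) 'X_[mset2 g i j (g i + t) (g j - t.+1)]
  else - \sum_(t < g i - g j) 'X_[mset2 g i j (g j + t) (g i - t.+1)].

(* The divided difference (p - K_ij p) / (x_j - x_i). *)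
Definition divdiff i j p : {mpoly F[N]} :=
  \sum_(g <- msupp p) p@_g *: divdiffX i j g.

Lemma mulX_mset2r i j g u v : i != j ->
  'X_j * 'X_[mset2 g i j u v] = 'X_[mset2 g i j u v.+1] :> {mpoly F[N]}.
Proof.
move=> nij; rewrite -mpolyXD; congr 'X_[_]; apply/mnmP => k.
rewrite mnmDE mnm1E !mnmE; case: (eqVneq k i) => [->|nki].
  by rewrite eq_sym (negbTE nij).
by rewrite eq_sym; case: eqP.
Qed.

Lemma mulX_mset2l i j g u v : i != j ->
  'X_i * 'X_[mset2 g i j u v] = 'X_[mset2 g i j u.+1 v] :> {mpoly F[N]}.
Proof.
move=> nij; rewrite -mpolyXD; congr 'X_[_]; apply/mnmP => k.
by rewrite mnmDE mnm1E !mnmE eq_sym; case: (eqVneq k i).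
Qed.

Lemma mset2_telescope i j g u d : i != j ->
  ('X_j - 'X_i) * (\sum_(t < d) 'X_[mset2 g i j (u + t) (u + d - t.+1)])
  = 'X_[mset2 g i j u (u + d)] - 'X_[mset2 g i j (u + d) u] :> {mpoly F[N]}.
Proof.
move=> nij; rewrite -[RHS]opprB.
pose f t : {mpoly F[N]} := 'X_[mset2 g i j (u + t) (u + d - t)].
have -> : 'X_[mset2 g i j (u + d) u] - 'X_[mset2 g i j u (u + d)] = f d - f 0%N.
  by rewrite /f addn0 subn0 addnK.
rewrite -(telescope_sumr f (leq0n d)) big_mkord mulr_sumr -sumrN.
apply: eq_bigr => t _; rewrite opprB mulrBl mulX_mset2r // mulX_mset2l // /f.
by congr ('X_[mset2 _ _ _ _ _] - 'X_[mset2 _ _ _ _ _]); have := ltn_ord t; lia.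
Qed.

Lemma mset2_id i j g : mset2 g i j (g i) (g j) = g.
Proof.
by apply/mnmP=> k; rewrite mnmE; case: eqP => [->//|_]; case: eqP => [->|].
Qed.

Lemma mset2_tperm i j g :
  mset2 g i j (g j) (g i) = [multinom g (tperm i j k) | k < N].
Proof.
apply/mnmP=> k; rewrite !mnmE.
case: tpermP => [->|->|/eqP/negbTE->/eqP/negbTE->//]; rewrite eqxx //.
by case: eqP => [->|].
Qed.

Lemma divdiffXE i j g : i != j ->
  ('X_j - 'X_i) * divdiffX i j g = 'X_[g] - msym (tperm i j) 'X_[g].
Proof.
move=> nij; rewrite msymX tpermV -mset2_tperm -[X in _ = 'X_[X] - _](mset2_id i j g) /divdiffX.
have [le|lt] := leqP (g i) (g j).
  have := mset2_telescope g (g i) (g j - g i) nij; rewrite subnKC //.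
have := mset2_telescope g (g j) (g i - g j) nij; rewrite subnKC 1?ltnW // => e.
by rewrite mulrN e opprB.
Qed.

Lemma divdiffE i j p : i != j ->
  ('X_j - 'X_i) * divdiff i j p = p - msym (tperm i j) p.
Proof.
move=> nij; rewrite [X in _ = X - _]mpolyE [X in _ = _ - msym _ X]mpolyE.
rewrite (linear_sum (msym (tperm i j))) /= -sumrB mulr_sumr; apply: eq_bigr => g _.
by rewrite -scalerAr divdiffXE // scalerBr msymZ.
Qed.

Lemma subX_neq0 i j : i != j -> 'X_j - 'X_i != 0 :> {mpoly F[N]}.
Proof.
move=> nij; apply/eqP => /(congr1 (mcoeff U_(j)))/eqP.
by rewrite mcoeffB !mcoeffXU eqxx (negbTE nij) subr0 mcoeff0 oner_eq0.
Qed.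

Lemma divdiff_uniq i j p q : i != j ->
  ('X_j - 'X_i) * q = p - msym (tperm i j) p -> divdiff i j p = q.
Proof.
by move=> nij e; apply: (mulfI (subX_neq0 nij)); rewrite e divdiffE.
Qed.

Lemma divdiff_diag j p : divdiff j j p = 0.
Proof.
apply: big1 => g _; rewrite /divdiffX leqnn subnn big_ord0 scaler0 //.
Qed.

Lemma divdiff_is_linear i j : linear (divdiff i j).
Proof.
move=> c p q; have [->|nij] := eqVneq i j.
  by rewrite !divdiff_diag scaler0 addr0.
apply: divdiff_uniq => //.
rewrite mulrDr -scalerAr !divdiffE // linearP /= scalerBr.
by rewrite opprD addrACA.
Qed.

HB.instance Definition _ i j :=
  GRing.isLinear.Build F {mpoly F[N]} {mpoly F[N]} *:%R (divdiff i j)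
    (divdiff_is_linear i j).

(** Both sums of the Cherednik operator have the variable of larger index as numerator; this choice
    merges them into one. *)
Definition later i j : 'I_N := if (i < j)%N then j else i.

Definition xi a j p : {mpoly F[N]} :=
  a *: ('X_j * p^`M(j))
  + \sum_(i | i != j) 'X_(later i j) * divdiff i j p - j%:R *: p.

Lemma xi_is_linear a j : linear (xi a j).
Proof.
move=> c p q; rewrite /xi.
rewrite linearP mulrDr -scalerAr scalerDr scalerA [a * c]mulrC -scalerA.
rewrite (eq_bigr (fun i => c *: ('X_(later i j) * divdiff i j p)
   + 'X_(later i j) * divdiff i j q)); last first.
  by move=> i _; rewrite linearP mulrDr -scalerAr.
rewrite big_split -scaler_sumr /= scalerDr [j%:R *: (c *: p)]scalerA.
rewrite [_ * c]mulrC -scalerA !scalerDr scalerN opprD.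
by rewrite -!addrA; congr (_ + _); rewrite addrCA; congr (_ + _); rewrite !addrA;
 congr (_ + _); rewrite -!addrA [RHS]addrCA; congr (_ + _); rewrite addrC.
Qed.

HB.instance Definition _ a j :=
  GRing.isLinear.Build F {mpoly F[N]} {mpoly F[N]} *:%R (xi a j)
    (xi_is_linear a j).

Lemma thetaX j g : 'X_j * ('X_[g])^`M(j) = (g j)%:R *: 'X_[g] :> {mpoly F[N]}.
Proof.
rewrite mderivX -scalerAr -mpolyXD; case: (eqVneq (g j) 0%N) => [->|nz].
  by rewrite !scale0r.
by congr (_ *: 'X_[_]); rewrite addmC submK // lep1mP.
Qed.

Lemma mcoeff_theta j p g : ('X_j * p^`M(j))@_g = (g j)%:R * p@_g.
Proof.
rewrite [in LHS](mpolyE p) [in RHS](mpolyE p) (linear_sum (mderiv j)) mulr_sumr.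
rewrite !(raddf_sum (mcoeff g)) mulr_sumr /=.
apply: eq_bigr => h _; rewrite mderivZ -scalerAr thetaX !mcoeffZ mcoeffX.
by case: eqP => [->|_]; rewrite ?mulr0 // mulrCA mulrC.
Qed.

Lemma msymXU (s : 'S_N) i : msym s 'X_i = 'X_(s i) :> {mpoly F[N]}.
Proof.
rewrite msymX; congr 'X_[_]; apply/mnmP => k; rewrite mnmE !mnm1E.
by rewrite (canF_eq (permK s)).
Qed.

Lemma msym_divdiff (s : 'S_N) i j p : i != j ->
  msym s (divdiff i j p) = divdiff (s i) (s j) (msym s p).
Proof.
move=> nij; apply/esym/divdiff_uniq; first by rewrite (inj_eq perm_inj).
rewrite -!msymXU -msymB -msymM divdiffE // msymB -!msymMm.
by rewrite -tpermJ -conjgC.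
Qed.

Lemma msym_theta (s : 'S_N) j p :
  msym s ('X_j * p^`M(j)) = 'X_(s j) * (msym s p)^`M(s j).
Proof.
by apply/mpolyP=> g; rewrite mcoeff_sym !mcoeff_theta mcoeff_sym mnmE.
Qed.

Lemma msym_xi (s : 'S_N) a j p :
  msym s (xi a j p) = a *: ('X_(s j) * (msym s p)^`M(s j))
    + \sum_(i | i != j) 'X_(s (later i j)) * divdiff (s i) (s j) (msym s p)
    - j%:R *: msym s p.
Proof.
rewrite /xi msymB msymD !msymZ msym_theta (linear_sum (msym s)) /=; congr (_ + _ - _).
by apply: eq_bigr => i nij; rewrite msymM msymXU msym_divdiff.
Qed.

Lemma xi_msym (s : 'S_N) a j p :
  xi a (s j) (msym s p) = a *: ('X_(s j) * (msym s p)^`M(s j))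
    + \sum_(i | i != j) 'X_(later (s i) (s j)) * divdiff (s i) (s j) (msym s p)
    - (s j)%:R *: msym s p.
Proof.
rewrite /xi (reindex_inj (@perm_inj _ s)) /=; congr (_ + _ - _).
by apply: eq_bigl => i; rewrite (inj_eq perm_inj).
Qed.

Section AdjacentTransposition.
Variables (k k' : 'I_N).
Hypothesis kk' : k' = k.+1 :> nat.
Let s := tperm k k'.

Lemma xi_tperm_other a j p : j != k -> j != k' ->
  xi a j (msym s p) = msym s (xi a j p).
Proof.
move=> jk jk'; have sj : s j = j by rewrite tpermD // eq_sym.
rewrite -{1}sj xi_msym msym_xi sj; congr (_ + _ - _).
apply: eq_bigr => i nij; congr ('X_ _ * _); rewrite /later.
have -> : (s i < j)%N = (i < j)%N.
  move: jk jk' nij; rewrite -!val_eqE /= /s.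
  by case: tpermP => [->|->|_ _] /=; lia.
by case: ifP; rewrite ?sj.
Qed.

(** Only the pair of [k] and [k'] is reversed. Its term leaves x_k' - x_k times a divided
    difference, which is [msym s p - p]; the constants differ by one and remove [msym s p]. *)
Lemma xi_tpermR a p : xi a k' (msym s p) = msym s (xi a k p) - p.
Proof.
have sk : s k = k' by rewrite tpermL.
have sk' : s k' = k by rewrite tpermR.
have nkk : k' != k by rewrite -val_eqE /=; lia.
rewrite -{1}sk xi_msym msym_xi sk.
rewrite (bigD1 k') //= [in RHS](bigD1 k') //= sk'.
have -> : later k k' = k' by rewrite /later kk' ltnSn.
have -> : s (later k' k) = k by rewrite /later kk' ltnNge leqnSn /= sk'.
rewrite [X in _ + (_ + X)](eq_bigr (fun i =>
   'X_(s (later i k)) * divdiff (s i) k' (msym s p))); last first.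
  move=> i /andP[nik nik']; congr ('X_ _ * _); rewrite /later.
  have si : s i = i by rewrite tpermD // eq_sym.
  rewrite si [s (if _ then _ else _)]fun_if sk si.
  have -> // : (i < k')%N = (i < k)%N.
  by move: nik nik'; rewrite -!val_eqE /= kk'; lia.
have nkk' : k != k' by rewrite eq_sym.
have := divdiffE (msym s p) nkk'; rewrite -msymMm tperm2 msym1m.
move/eqP; rewrite mulrBl subr_eq => /eqP ->; rewrite kk' -natr1 scalerDl scale1r.
ring.
Qed.

Lemma xi_tpermL a p : xi a k (msym s p) = msym s (xi a k' p) + p.
Proof.
apply: (inj_msym s); rewrite msymD -msymMm tperm2 msym1m.
have := xi_tpermR a (msym s p); rewrite -msymMm tperm2 msym1m => ->.
by rewrite subrK.
Qed.

(* The intertwiner of the degenerate affine Hecke algebra, with denominator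
   cleared. *)
Lemma intertwiner_eigen a (e : 'I_N -> F) p :
  (forall j, xi a j p = e j *: p) ->
  forall j, xi a j ((e k' - e k) *: msym s p + p)
    = e (s j) *: ((e k' - e k) *: msym s p + p).
Proof.
move=> ep j; rewrite linearP /=.
have [->|jk] := eqVneq j k.
  rewrite xi_tpermL !ep msymZ tpermL -!mul_mpolyC !(mpolyCB, mpolyCM); ring.
have [->|jk'] := eqVneq j k'.
  rewrite xi_tpermR !ep msymZ tpermR -!mul_mpolyC !(mpolyCB, mpolyCM); ring.
rewrite xi_tperm_other // !ep msymZ tpermD 1?eq_sym // -!mul_mpolyC; ring.
Qed.

(** If the sum vanished, applying the involution s to p = - d s(p) would give p = d^2 p. *)
Lemma intertwiner_neq0 (d : F) p : d ^+ 2 != 1 -> p != 0 -> d *: msym s p + p != 0.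
Proof.
move=> d2 nz; apply: contra_neq nz => /eqP; rewrite addrC addr_eq0 => /eqP e.
have e2 : msym s p = - (d *: p).
  by rewrite {1}e msymN msymZ -msymMm tperm2 msym1m.
have : (1 - d ^+ 2) *: p = 0.
  by rewrite scalerBl scale1r expr2 -scalerA -[d *: p]opprK -e2 scalerN -e subrr.
by move/eqP; rewrite -mul_mpolyC mulf_eq0 mpolyC_eq0 subr_eq0 eq_sym (negbTE d2) /= => /eqP.
Qed.

End AdjacentTransposition.
End Operators.

(** * The raising operator and its commutation with the Cherednik operators *)

Section AffineIntertwiner.
Variables (F : idomainType) (n : nat).
Local Notation N := n.+1.
Implicit Types (a : F) (i j k : 'I_N) (p q : {mpoly F[N]}).

Definition cyc : 'S_N := perm (@ord_pred_inj N).

Lemma cyc0 : cyc ord0 = ord_max.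
Proof. by apply/val_inj; rewrite permE /= modn_small. Qed.

Lemma cycS j : j != ord0 -> (cyc j).+1 = j :> nat.
Proof.
rewrite -val_eqE /= permE /= => nz.
have -> : (j + n.+1).-1 = (j.-1 + n.+1)%N by lia.
by rewrite modnDr modn_small; have := ltn_ord j; lia.
Qed.

Lemma cyc_max j : (cyc j == ord_max) = (j == ord0).
Proof. by rewrite -cyc0 (inj_eq perm_inj). Qed.

Definition raising p : {mpoly F[N]} := 'X_ord_max * msym cyc p.

(** With the next two lemmas, a Leibniz rule for multiplication by a variable: a correction by [q]
    appears only if that variable is one of the two exchanged. *)
Lemma divdiff_mulX (t i j : 'I_N) q : i != j -> t != i -> t != j ->
  divdiff i j ('X_t * q) = 'X_t * divdiff i j q.
Proof.
move=> nij ti tj; apply: divdiff_uniq => //.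
by rewrite mulrCA divdiffE // mulrBr msymM msymXU tpermD // eq_sym.
Qed.

Lemma divdiff_mulXr i j q : i != j ->
  divdiff i j ('X_j * q) = q + 'X_i * divdiff i j q.
Proof.
move=> nij; apply: divdiff_uniq => //.
rewrite mulrDr mulrCA divdiffE // msymM msymXU tpermR; ring.
Qed.

Lemma divdiff_mulXl i j q : i != j ->
  divdiff i j ('X_i * q) = - q + 'X_j * divdiff i j q.
Proof.
move=> nij; apply: divdiff_uniq => //.
rewrite mulrDr mulrCA divdiffE // msymM msymXU tpermL; ring.
Qed.

Lemma theta_mulX (t j : 'I_N) q :
  'X_j * ('X_t * q)^`M(j) = 'X_t * ('X_j * q^`M(j)) + (t == j)%:R *: ('X_t * q).
Proof.
rewrite mderivM mulrDr [X in X + _ = _]mulrA thetaX mnm1E addrC -!mul_mpolyC; ring.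
Qed.

Lemma xi_raising a j p :
  xi a (cyc j) (raising p) = raising (xi a j p + (j == ord0)%:R *: (a *: p)).
Proof.
rewrite /raising msymD mulrDr msym_xi /xi theta_mulX.
rewrite (reindex_inj (@perm_inj _ cyc)) /=.
set q := msym cyc p; rewrite [ord_max == _]eq_sym cyc_max !msymZ -/q.
rewrite (eq_bigl (fun i => i != j)); last by move=> i; rewrite (inj_eq perm_inj).
have [->|nj] := eqVneq j ord0.
  (* Index 0 becomes the last: each of the [n] other indices yields one extra x_N q, which together
     cancel the constant [n] of the last operator. *)
  rewrite cyc0 [X in _ + X - _](eq_bigr (fun i =>
    'X_ord_max * q + 'X_ord_max * ('X_(cyc (later i ord0)) * divdiff (cyc i) ord_max q))).
    rewrite big_split /= sumr_const cardC1 card_ord -mulr_sumr /=.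
    rewrite !scale1r !scale0r -(mulr_natl ('X_ord_max * q)) -!mul_mpolyC mpolyC_nat; ring.
  move=> i ni; have nc : cyc i != ord_max by rewrite cyc_max.
  rewrite divdiff_mulXr // /later ltn0.
  have -> : (cyc i < @ord_max n)%N.
    by move: nc; rewrite -val_eqE /=; have := ltn_ord (cyc i); lia.
  by rewrite mulrDr.
have nc : cyc j != ord_max by rewrite cyc_max.
(* Only the pair with index 0 is reversed; its extra - x_N q makes up for the constant falling from
   j to j - 1. *)
rewrite (bigD1 ord0) 1?eq_sym //= [X in _ = _ * (_ + X - _) + _](bigD1 ord0) 1?eq_sym //=.
rewrite cyc0 divdiff_mulXl 1?eq_sym //.
have -> : later ord_max (cyc j) = ord_max.
  by rewrite /later ltnNge -ltnS ltn_ord.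
have -> : later ord0 j = j by rewrite /later lt0n -val_eqE /= in nj *; rewrite nj.
rewrite [X in _ + (_ + X) - _](eq_bigr (fun i =>
  'X_ord_max * ('X_(cyc (later i j)) * divdiff (cyc i) (cyc j) q))).
  rewrite -mulr_sumr -[in X in _ = X](cycS nj) -[(_.+1)%:R]natr1 !scale0r.
  by rewrite -!mul_mpolyC mpolyCD mpolyC1; ring.
move=> i /andP[nij ni]; have nci : cyc i != ord_max by rewrite cyc_max.
rewrite divdiff_mulX ?(inj_eq perm_inj) //; try by rewrite eq_sym.
rewrite mulrCA; congr (_ * ('X_ _ * _)).
rewrite /later [cyc (if _ then _ else _)]fun_if.
have -> // : (cyc i < cyc j)%N = (i < j)%N.
by rewrite -(cycS ni) -(cycS nj).
Qed.

Lemma raising_neq0 p : p != 0 -> raising p != 0.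
Proof.
move=> nz; rewrite mulf_neq0 //.
  apply/eqP => /(congr1 (mcoeff U_(ord_max)))/eqP.
  by rewrite mcoeffXU eqxx mcoeff0 oner_eq0.
by apply: contra_neq nz => e; apply: (inj_msym cyc); rewrite e msym0.
Qed.

End AffineIntertwiner.

(** * Triangularity and the consequences of a separated spectrum *)

Section Triangularity.
Variables (F : idomainType) (N : nat).
Implicit Types (a : F) (i j k : 'I_N) (g h l : 'X_{1..N}) (p q : {mpoly F[N]}).

(** The eigenvalue of the statement with its two counts merged into one rank, over any domain. *)
Definition spec a l j : F := a * (l j)%:R - (rank l j)%:R.

Lemma mset2E i j g u v : i != j ->
  [/\ mset2 g i j u v i = u, mset2 g i j u v j = v &
      forall k, k != i -> k != j -> mset2 g i j u v k = g k].
Proof.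
move=> nij; split; rewrite ?mnmE ?eqxx //.
  by rewrite eq_sym (negbTE nij).
by move=> k /negbTE ki /negbTE kj; rewrite mnmE ki kj.
Qed.

Lemma comp_gt_mset2 i j g u v : i != j -> (u + v = g i + g j)%N ->
  (maxn u v < maxn (g i) (g j))%N -> comp_gt g (mset2 g i j u v).
Proof.
move=> nij us um; have [ei ej eo] := mset2E g u v nij.
by apply: (@comp_gt_between _ _ _ i j); rewrite ?ei ?ej.
Qed.

Lemma comp_gt_mset2_swap i j g : (i < j)%N -> (g j < g i)%N ->
  comp_gt g (mset2 g i j (g j) (g i)).
Proof.
move=> ij gij; apply: (@comp_gt_swap _ _ _ i j) => // k.
by rewrite mset2_tperm mnmE.
Qed.

Lemma mset2C i j g u v : i != j -> mset2 g i j u v = mset2 g j i v u.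
Proof.
move=> nij; apply/mnmP => k; rewrite !mnmE; case: (eqVneq k i) => [->|//].
by rewrite (negbTE nij).
Qed.

(* q is the multiple c of 'X_[g], up to monomials strictly below g. *)
Definition lead_lower g (c : F) q : Prop :=
  forall h, ~~ comp_gt g h -> q@_h = c * (h == g)%:R.

Lemma lead_lower_sum (I : Type) (r : seq I) (P : pred I) g (c : I -> F)
    (q : I -> {mpoly F[N]}) :
  (forall x, P x -> lead_lower g (c x) (q x)) ->
  lead_lower g (\sum_(x <- r | P x) c x) (\sum_(x <- r | P x) q x).
Proof.
move=> H h gh; rewrite raddf_sum /= mulr_suml; apply: eq_bigr => i Pi.
exact: H.
Qed.

Lemma lead_lower_sum0 (I : Type) (r : seq I) (P : pred I) g
    (q : I -> {mpoly F[N]}) :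
  (forall x, P x -> lead_lower g 0 (q x)) ->
  lead_lower g 0 (\sum_(x <- r | P x) q x).
Proof. by move=> H; have := lead_lower_sum r H; rewrite big1. Qed.

Lemma lead_lowerX g h : comp_gt g h -> lead_lower g 0 'X_[h].
Proof.
move=> gh k ngk; rewrite mcoeffX mul0r; case: eqP => // e.
by rewrite -e gh in ngk.
Qed.

Lemma lead_lowerXX g : lead_lower g 1 'X_[g].
Proof. by move=> k _; rewrite mcoeffX mul1r eq_sym. Qed.

Lemma lead_lowerD g c d p q :
  lead_lower g c p -> lead_lower g d q -> lead_lower g (c + d) (p + q).
Proof. by move=> H K h gh; rewrite mcoeffD mulrDl H // K. Qed.

Lemma lead_lowerN g c p : lead_lower g c p -> lead_lower g (- c) (- p).
Proof. by move=> H h gh; rewrite mcoeffN mulNr H. Qed.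

Lemma lead_lowerZ g b c p : lead_lower g c p -> lead_lower g (b * c) (b *: p).
Proof. by move=> H h gh; rewrite mcoeffZ H // mulrA. Qed.

(** Inner terms bring the exponents at [i] and [j] closer and so are lower. After multiplication by
    the later variable the extreme term is either x^g, giving the coefficient 1 or -1, or the swap
    moving the larger part to the right, which is lower too. *)
Lemma lead_lower_divdiffX i j g : i != j ->
  lead_lower g (((i < j) && (g i < g j))%N%:R - ((j < i) && (g j < g i))%N%:R)
    ('X_(later i j) * divdiffX F i j g).
Proof.
move=> nij; rewrite /divdiffX /later; have nij' : (i != j :> nat) by [].
have [lt|ge] := ltnP i j; have [le'|lt'] := leqP (g i) (g j).
- rewrite (ltnNge j i) (ltnW lt) /= subr0 mulr_sumr.
  case: (posnP (g j - g i)%N) => [e|pos].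
    rewrite e big_ord0 (_ : (g i < g j)%N = false); last lia.
    by move=> h _; rewrite mcoeff0 mul0r.
  rewrite (_ : (g i < g j)%N); last lia.
  rewrite -(prednK pos) big_ord_recl -[1%:R]addr0; apply: lead_lowerD.
    rewrite mulX_mset2r //= addn0 (_ : (g j - 1).+1 = g j); last lia.
    by rewrite mset2_id; exact: lead_lowerXX.
  apply: lead_lower_sum0 => t _; rewrite mulX_mset2r //; apply: lead_lowerX.
  by apply: comp_gt_mset2 => //=; rewrite /bump /=; have := ltn_ord t; lia.
- rewrite (ltnNge j i) (ltnW lt) (ltnNge (g i)) (ltnW lt') /= subr0 -[0%:R]oppr0 mulrN.
  apply: lead_lowerN; rewrite mulr_sumr.
  apply: lead_lower_sum0 => t _; rewrite mulX_mset2r //; apply: lead_lowerX.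
  case: (posnP t) => [->|tpos].
    rewrite addn0 subnSK ?subn0; last lia.
    exact: comp_gt_mset2_swap.
  by apply: comp_gt_mset2 => //=; have := ltn_ord t; lia.
- rewrite (_ : (j < i)%N); last lia.
  rewrite /= subr0 mulr_sumr.
  apply: lead_lower_sum0 => t _; rewrite mulX_mset2l //; apply: lead_lowerX.
  case: (eqVneq t.+1 (g j - g i)%N) => [e|ne].
    rewrite -addnS e subnKC // subKn // mset2C //.
    by apply: comp_gt_mset2_swap; have := ltn_ord t; lia.
  by apply: comp_gt_mset2 => //=; have := ltn_ord t; lia.
- rewrite (_ : (j < i)%N); last lia.
  rewrite /= sub0r mulrN; apply: lead_lowerN; rewrite mulr_sumr.
  have pos : (0 < g i - g j)%N by lia.
  rewrite -(prednK pos) big_ord_recr -[1%:R]add0r; apply: lead_lowerD.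
    apply: lead_lower_sum0 => t _; rewrite mulX_mset2l //; apply: lead_lowerX.
    by apply: comp_gt_mset2 => //=; have := ltn_ord t; lia.
  rewrite mulX_mset2l //= prednK // -addnS prednK // subKn 1?ltnW //.
  by rewrite subnKC 1?ltnW // mset2_id; exact: lead_lowerXX.
Qed.

Lemma divdiffX_eq i j g : divdiff i j 'X_[g] = divdiffX F i j g.
Proof. by rewrite /divdiff msuppX big_seq1 mcoeffX eqxx scale1r. Qed.

(** An index i < j contributes [l_i < l_j] - 1 = -[l_j <= l_i], an index i > j contributes
    -[l_j < l_i]; together they count the predecessors of [j]. *)
Lemma sum_rank l j :
  \sum_(i | i != j) (((i < j) && (l i < l j))%N%:R - ((j < i) && (l j < l i))%N%:R)
    - j%:R = - (rank l j)%:R :> F.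
Proof.
have -> : j%:R = \sum_(i | i != j) (i < j)%N%:R :> F.
  rewrite -natr_sum; congr _%:R.
  rewrite -[LHS]card_ord -sum1_card (big_ord_widen N (fun=> 1%N)) 1?ltnW //.
  rewrite big_mkcond [RHS]big_mkcond; apply: eq_bigr => i _.
  by have [->|] := eqVneq i j; rewrite ?ltnn.
have -> : (rank l j)%:R = \sum_(i | i != j) (before l i j)%:R :> F.
  rewrite -natr_sum; congr _%:R; rewrite /rank -sum1dep_card.
  rewrite big_mkcond [RHS]big_mkcond; apply: eq_bigr => i _.
  by have [->|] := eqVneq i j; rewrite ?before_irr.
rewrite -sumrB -sumrN; apply: eq_bigr => i; rewrite -val_eqE /= => nij.
rewrite /before; case: (ltngtP i j) nij => //= ij _; case: (ltngtP (l i) (l j)) => //= _;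
  by rewrite ?mulr0n ?mulr1n ?(subr0, sub0r, subrr, oppr0).
Qed.

Lemma lead_lower_xi a j g : lead_lower g (spec a g j) (xi a j 'X_[g]).
Proof.
rewrite /spec -sum_rank addrA /xi.
apply: lead_lowerD; first apply: lead_lowerD.
- rewrite thetaX -{1}[(g j)%:R]mulr1; do 2!apply: lead_lowerZ.
  exact: lead_lowerXX.
- apply: lead_lower_sum => i nij; rewrite divdiffX_eq; exact: lead_lower_divdiffX.
- by apply: lead_lowerN; rewrite -{1}[j%:R]mulr1; apply: lead_lowerZ; exact: lead_lowerXX.
Qed.

Lemma xiZ a j c p : xi a j (c *: p) = c *: xi a j p.
Proof. exact: linearZ. Qed.

Lemma mcoeff_xi a j p h :
  (xi a j p)@_h = spec a h j * p@_h
    + \sum_(g <- msupp p | comp_gt g h) p@_g * (xi a j 'X_[g])@_h.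
Proof.
rewrite {1}[p]mpolyE (linear_sum (xi a j)) (raddf_sum (mcoeff h)) /=.
rewrite (bigID (fun g => comp_gt g h)) addrC /=; congr (_ + _).
  by apply: eq_bigr => g _; rewrite xiZ mcoeffZ.
transitivity (\sum_(g <- msupp p | g == h) p@_g * spec a g j).
  rewrite big_mkcond [RHS]big_mkcond; apply: eq_bigr => g _.
  rewrite xiZ mcoeffZ /=; case: ifP => [ngh|/negbFE gh].
    rewrite (lead_lower_xi a j ngh) eq_sym.
    by case: (g == h); rewrite ?mulr1 ?mulr0.
  by case: eqP gh => // ->; rewrite comp_gt_irr.
have [hp|hp] := boolP (h \in msupp p).
  rewrite (big_rem h hp) /= eqxx mulrC big_seq_cond big1 ?addr0 // => g /andP[].
  by rewrite mem_rem_uniq ?msupp_uniq // inE => /andP[/negbTE->].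
rewrite (memN_msupp_eq0 hp) mulr0 big_seq_cond big1 // => g /andP[gp /eqP e].
by rewrite -e gp in hp.
Qed.

Definition joint_eigen a l p : Prop := forall j, xi a j p = spec a l j *: p.

(** Compositions of every degree compete, so eigenvectors need not be known to be homogeneous. *)
Definition separated a l : Prop :=
  forall g, (forall j, spec a g j = spec a l j) -> g = l.

Definition below_card (d : nat) g : nat :=
  #|[set h : 'X_{1..N < d} | comp_gt g h]|.

Lemma below_card_lt d g h : (mdeg h < d)%N -> comp_gt g h ->
  (below_card d h < below_card d g)%N.
Proof.
move=> hd gh; apply: proper_card; apply/properP; split.
  by apply/subsetP => k; rewrite !inE; exact: comp_gt_trans.
by exists (BMultinom hd); rewrite !inE /= ?comp_gt_irr.
Qed.

(** Induction downwards from the maximal monomials: the support is finite and [below_card] grows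
    strictly upwards. *)
Lemma msupp_ind p (P : 'X_{1..N} -> Prop) :
  (forall g, g \in msupp p ->
     (forall h, h \in msupp p -> comp_gt h g -> P h) -> P g) ->
  forall g, g \in msupp p -> P g.
Proof.
move=> step; pose f := below_card (msize p); pose c := #|{: 'X_{1..N < msize p}}|.
suff H b g : (c - f g <= b)%N -> g \in msupp p -> P g by move=> g; exact: (H (c - f g)%N).
elim: b g => [|b IH] g le gp; apply: step => // h hp hg.
  have lt := below_card_lt (msize_mdeg_lt gp) hg.
  have : (f h <= c)%N by exact: max_card.
  by move: le lt; rewrite -/f; lia.
apply: IH => //; have lt := below_card_lt (msize_mdeg_lt gp) hg.
have : (f h <= c)%N by exact: max_card.
by move: le lt; rewrite -/f; lia.
Qed.

(* A maximal monomial of p sees only its own diagonal coefficient. *)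
Lemma joint_eigen_max a l p g : separated a l -> joint_eigen a l p ->
  g \in msupp p -> (forall h, h \in msupp p -> ~~ comp_gt h g) -> g = l.
Proof.
move=> sep ep gp none; apply: sep => j; have := mcoeff_xi a j p g.
rewrite big_seq_cond big1 ?addr0 => [|h /andP[hp hg]]; last first.
  by have := none h hp; rewrite hg.
by rewrite ep mcoeffZ => /esym/mulIf; apply; rewrite -mcoeff_msupp.
Qed.

Lemma joint_eigen_support a l p g : separated a l -> joint_eigen a l p ->
  g \in msupp p -> g = l \/ comp_gt l g.
Proof.
move=> sep ep; move: g; apply: msupp_ind => g gp IH.
have [/hasP[h hp hg]|/hasPn none] := boolP (has (fun h => comp_gt h g) (msupp p)).
  by right; have [<-|lh] := IH h hp hg => //; exact: comp_gt_trans hg.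
by left; apply: (joint_eigen_max sep ep gp) => h hp; exact: none.
Qed.

(** Every maximal monomial is x^l; if that one is missing, the support is empty. *)
Lemma joint_eigen_coeff a l p : separated a l -> joint_eigen a l p ->
  p@_l = 0 -> p = 0.
Proof.
move=> sep ep pl; apply/eqP; rewrite -msupp_eq0.
suff H : forall g, g \in msupp p -> False.
  by case E : (msupp p) => [//|g s]; case: (H g); rewrite E inE eqxx.
apply: msupp_ind => g gp IH; have e : g = l.
  by apply: joint_eigen_max ep gp _ => // h hp; apply/negP => /(IH h hp).
by move: gp; rewrite mcoeff_msupp e pl eqxx.
Qed.

End Triangularity.

(** * Joint eigenvectors built from the constant 1 *)

Section Existence.
Variables (F : idomainType) (N : nat).
Implicit Types (a : F) (i j k : 'I_N) (g h l : 'X_{1..N}) (p q : {mpoly F[N]}).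

Lemma joint_eigen1 a : joint_eigen a (0%MM : 'X_{1..N}) (1 : {mpoly F[N]}).
Proof.
move=> j; have := sum_rank F (0%MM : 'X_{1..N}) j.
rewrite big1 => [|i _]; last by rewrite !mnm0E !ltnn !andbF subrr.
rewrite sub0r /spec /xi mnm0E mulr0 sub0r => <-.
rewrite -[1](mpolyC1 N F) mderivC mulr0 scaler0 add0r big1 ?sub0r ?scaleNr //.
move=> i nij; rewrite (_ : divdiff _ _ _ = 0) ?mulr0 //; apply: divdiff_uniq => //.
by rewrite mulr0 mpolyC1 msym1 subrr.
Qed.

(** The two parts differ and their indices are adjacent, so no tie is decided differently and the
    swap just permutes the ranks. *)
Lemma joint_eigen_swap a l p (k k' : 'I_N) : k' = k.+1 :> nat -> l k != l k' ->
  joint_eigen a [multinom l (tperm k k' i) | i < N] p ->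
  joint_eigen a l ((spec a l k - spec a l k') *: msym (tperm k k') p + p).
Proof.
move=> kk' ne ep; set l' := [multinom _ | _ < _] in ep.
have l'E i : l' (tperm k k' i) = l i by rewrite mnmE tpermK.
have sE i : spec a l' (tperm k k' i) = spec a l i.
  rewrite /spec l'E; congr (_ - _%:R); apply: rank_perm => {}i j.
  rewrite /before !l'E; case: (ltngtP (l j) (l i)) => //= e.
  have ni : ~ (i = k /\ j = k') by case=> ii jj; move: ne; rewrite -ii -jj e eqxx.
  have nj : ~ (i = k' /\ j = k) by case=> ii jj; move: ne; rewrite -ii -jj e eqxx.
  case: tpermP => [ii|ii|/eqP ii /eqP ii']; case: tpermP => [jj|jj|/eqP jj /eqP jj'];
    try (by case: ni); try (by case: nj); rewrite ?ii ?jj ?ltnn //;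
    move: ii jj; try move: ii'; try move: jj'; rewrite -?val_eqE /=; lia.
have <- : spec a l' k' = spec a l k by rewrite -(sE k) tpermL.
have <- : spec a l' k = spec a l k' by rewrite -(sE k') tpermR.
by move=> j; have := intertwiner_eigen kk' ep j; rewrite sE.
Qed.

End Existence.

(** Ranks survive the move of the raised part to the end: a tie it won by index it now wins by size,
    and a tie newly created is lost by index, as it was by size before. *)
Lemma joint_eigen_raising (F : idomainType) (n : nat) (a : F) (l l' : 'X_{1..n.+1})
    (p : {mpoly F[n.+1]}) :
  (forall i, l (cyc n i) = (l' i + (i == ord0))%N) ->
  joint_eigen a l' p -> joint_eigen a l (raising p).
Proof.
move=> lE ep j; rewrite -(permKV (cyc n) j); set i := ((cyc n)^-1)%g j.
rewrite xi_raising ep scalerA -scalerDl /raising msymZ -scalerAr; congr (_ *: _).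
rewrite /spec lE (@rank_perm _ l') => [|u v].
  by rewrite natrD mulrDr addrAC [_%:R * a]mulrC.
rewrite /before !lE.
have [->|nu] := eqVneq u ord0; have [->|nv] := eqVneq v ord0.
- by rewrite !ltnn !andbF.
- rewrite cyc0; have := cycS nv; move: nv; rewrite -val_eqE /=; have := ltn_ord v; lia.
- rewrite cyc0; have := cycS nu; move: nu; rewrite -val_eqE /=; have := ltn_ord u; lia.
- by rewrite -(cycS nu) -(cycS nv) !addn0 ltnS.
Qed.

(** Induction on the degree, then on [wt]. A positive last part comes from raising a composition of
    lower degree; otherwise the last positive part is moved one place to the right, which lowers
    [wt]. The hypothesis keeps the intertwiner from vanishing. *)
Lemma exists_joint_eigen (F : idomainType) (N : nat) (a : F) :
  (forall (l : 'X_{1..N}) k k', l k != l k' -> (spec a l k - spec a l k') ^+ 2 != 1) ->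
  forall l : 'X_{1..N}, exists2 p : {mpoly F[N]}, p != 0 & joint_eigen a l p.
Proof.
case: N => [|n] gen l; first by exists 1; [exact: oner_neq0 | case].
pose wt (l : 'X_{1..n.+1}) := (\sum_i l i * (n.+1 - i))%N.
move: {2}(mdeg l) (erefl (mdeg l)) => d; elim/ltn_ind: d l => d IHd l.
move: {2}(wt l) (erefl (wt l)) => w; elim/ltn_ind: w l => w IHw l lw ld.
have [->|nz] := eqVneq l 0%MM.
  by exists 1; [exact: oner_neq0 | exact: joint_eigen1].
have [lm|lm] := posnP (l ord_max); last first.
  pose l' : 'X_{1..n.+1} := [multinom (l (cyc n i) - (i == ord0))%N | i < n.+1].
  have lE i : l (cyc n i) = (l' i + (i == ord0))%N.
    by rewrite mnmE subnK //; case: eqP => // ->; rewrite cyc0.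
  have [||p pnz ep] := IHd (mdeg l') _ l' => //.
    rewrite -ld !mdegE [X in (_ < X)%N](reindex_inj (@perm_inj _ (cyc n))) /=.
    rewrite [X in (_ < X)%N](eq_bigr (fun i => l' i + (i == ord0))%N) // big_split /=.
    by rewrite -[X in (X < _)%N]addn0 ltn_add2l (bigD1 ord0).
  by exists (raising p); [exact: raising_neq0 | exact: joint_eigen_raising ep].
have [i0 li0] : exists i0, (0 < l i0)%N.
  apply/existsP; apply: contraNT nz; rewrite negb_exists => /forallP H.
  by apply/eqP/mnmP => i; rewrite mnm0E; apply/eqP; rewrite -leqn0 leqNgt H.
case: (@arg_maxnP _ i0 (fun i => 0 < l i)%N (fun i : 'I_n.+1 => i : nat) li0) => k lk kmax.
have kn : (k.+1 < n.+1)%N.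
  rewrite ltnS ltn_neqAle -ltnS ltn_ord andbT; apply: contraTneq lk => e.
  by rewrite -leqNgt (_ : k = ord_max) ?lm //; apply/val_inj.
pose k' := Ordinal kn; have lk' : l k' = 0%N.
  by apply/eqP; rewrite -leqn0 leqNgt; apply/negP => /kmax /=; rewrite ltnn.
have nkk : k != k' by rewrite -val_eqE /= neq_ltn ltnSn.
pose l' : 'X_{1..n.+1} := [multinom l (tperm k k' i) | i < n.+1].
have l'o i : i != k -> i != k' -> l' i = l i.
  by move=> ik ik'; rewrite mnmE tpermD // eq_sym.
have l'k : l' k = l k' by rewrite mnmE tpermL.
have l'k' : l' k' = l k by rewrite mnmE tpermR.
have [||p pnz ep] := IHw (wt l') _ l' erefl.
- rewrite -lw /wt !(big_two _ nkk) l'k l'k' lk' !mul0n add0n addn0.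
  rewrite (eq_bigr (fun i : 'I_n.+1 => l i * (n.+1 - i))%N) => [|i /andP[ik ik']].
    by rewrite ltn_add2r ltn_pmul2l //=; lia.
  by rewrite l'o.
- rewrite -ld; symmetry; apply: (mdeg_two nkk) => [i ik ik'|].
    by rewrite l'o.
  by rewrite l'k l'k' addnC.
have ne : l k != l k' by rewrite lk' -lt0n.
exists ((spec a l k - spec a l k') *: msym (tperm k k') p + p).
  by apply: intertwiner_neq0 => //; exact: gen.
exact: joint_eigen_swap.
Qed.

(** * Change of coefficient ring *)

Section Morphism.
Variables (F G : idomainType) (f : {rmorphism F -> G}) (N : nat).
Implicit Types (a : F) (j : 'I_N) (p : {mpoly F[N]}).

(** Serves both the evaluation of K[alpha] at a point and the inclusion of K[alpha] in K(alpha). *)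
Lemma map_mpoly_xi a j p : map_mpoly f (xi a j p) = xi (f a) j (map_mpoly f p).
Proof.
have dd i : i != j -> map_mpoly f (divdiff i j p) = divdiff i j (map_mpoly f p).
  move=> nij; apply/esym/divdiff_uniq => //.
  rewrite -!(map_mpolyX f) -rmorphB -rmorphM divdiffE // rmorphB; congr (_ - _).
  by apply/mpolyP => g; rewrite mcoeff_map_mpoly !mcoeff_sym mcoeff_map_mpoly.
rewrite /xi rmorphB rmorphD rmorph_sum /= !map_mpolyZ rmorph_nat.
congr (_ *: _ + _ - _).
  apply/mpolyP => g; rewrite mcoeff_map_mpoly !mcoeff_theta mcoeff_map_mpoly /=.
  by rewrite rmorphM rmorph_nat.
by apply: eq_bigr => i nij; rewrite rmorphM /= map_mpolyX dd.
Qed.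

Lemma map_spec a (l : 'X_{1..N}) j : f (spec a l j) = spec (f a) l j.
Proof. by rewrite /spec rmorphB rmorphM !rmorph_nat. Qed.

Lemma map_joint_eigen a l p :
  joint_eigen a l p -> joint_eigen (f a) l (map_mpoly f p).
Proof. by move=> ep j; rewrite -map_mpoly_xi ep map_mpolyZ map_spec. Qed.

End Morphism.

(** * Passage to the operators and eigenvalues of the statement *)

Section Bridge.
Variables (F : fieldType) (N : nat).
Implicit Types (a : F) (j : 'I_N) (l : 'X_{1..N}) (p E : {mpoly F[N]}).

Lemma cherednikE a j p : cherednik a j p = FracField.tofrac (xi a j p).
Proof.
have term i : i != j ->
    FracField.tofrac ('X_(later i j) * divdiff i j p)
    = FracField.tofrac 'X_(later i j) / FracField.tofrac ('X_j - 'X_i)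
      * FracField.tofrac (p - msym (tperm i j) p).
  move=> nij; rewrite -divdiffE // !rmorphM /= mulrA divfK //.
  by rewrite tofrac_eq0 subX_neq0.
rewrite /cherednik /xi rmorphB rmorphD rmorph_sum /=; congr (_ - _).
rewrite -addrA; congr (_ + _).
rewrite [RHS](bigID (fun i : 'I_N => (i < j)%N)) /=; congr (_ + _).
  apply: eq_big => [i|i ij]; first by rewrite -val_eqE /=; lia.
  by rewrite term /later ?ij // -val_eqE /=; lia.
apply: eq_big => [i|i ji]; first by rewrite -val_eqE /=; lia.
have nij : i != j by rewrite -val_eqE /=; lia.
by rewrite term /later // ltnNge (ltnW ji).
Qed.

Lemma eigenvalE a l j : eigenval a l j = spec a l j.
Proof.
rewrite /eigenval /spec -addrA -opprD -natrD; congr (_ - _%:R).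
rewrite /rank -cardsUI [X in (_ + X)%N](_ : _ = 0%N) ?addn0.
  apply: eq_card => i; rewrite !inE /before; have [->|] := eqVneq i j.
    by rewrite !ltnn /= !andbF.
  by rewrite -val_eqE /=; lia.
by apply/eqP; rewrite cards_eq0; apply/eqP/setP => i; rewrite !inE; lia.
Qed.

Lemma cherednik_eigenP a l p : cherednik_eigen a l p <-> joint_eigen a l p.
Proof.
split=> H j; last by rewrite cherednikE H eigenvalE.
by apply/eqP; rewrite -tofrac_eq; apply/eqP; rewrite -cherednikE H eigenvalE.
Qed.

Lemma unitriangularP l E :
  (forall g, g \in msupp E -> g = l \/ comp_gt l g) -> E@_l = 1 ->
  unitriangular l E.
Proof.
move=> sup El; exists (fun g => E@_g); apply/mpolyP => h.
rewrite mcoeffD raddf_sum mcoeffX /=.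
have [<-|nlh] := eqVneq l h.
  rewrite El big1 ?addr0 // => g lg; rewrite mcoeffZ mcoeffX.
  by case: eqP lg => [->|]; rewrite ?comp_gt_irr ?mulr0.
rewrite add0r; have [lh|lh] := boolP (comp_gt l h).
  have hd : (mdeg h < (mdeg l).+1)%N by case/and3P: lh => /eqP ->.
  rewrite (bigD1 (BMultinom hd)) //= mcoeffZ mcoeffX eqxx mulr1 big1 ?addr0 //.
  move=> g /andP[_ ne]; rewrite mcoeffZ mcoeffX.
  by case: eqP => [e|]; rewrite ?mulr0 //; case/eqP: ne; apply/val_inj.
rewrite big1 => [|g lg]; last first.
  rewrite mcoeffZ mcoeffX; case: eqP => [e|]; rewrite ?mulr0 //.
  by rewrite -e lg in lh.
apply: memN_msupp_eq0; apply/negP => /sup[e|]; last by apply/negP.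
by rewrite e eqxx in nlh.
Qed.

Lemma unitriangular_coeff l E : unitriangular l E -> E@_l = 1.
Proof.
case=> c ->; rewrite mcoeffD mcoeffX eqxx raddf_sum big1 ?addr0 // => g lg /=.
rewrite mcoeffZ mcoeffX; case: eqP lg => [->|]; by rewrite ?comp_gt_irr ?mulr0.
Qed.

(** Two normalised eigenvectors differ by a joint eigenvector without x^l, which is zero. *)
Lemma unique_nsJack a l p : separated a l -> joint_eigen a l p -> p@_l != 0 ->
  unique (is_nsJack a l) ((p@_l)^-1 *: p).
Proof.
move=> sep ep nz; set E := _ *: p.
have eE : joint_eigen a l E.
  by move=> j; rewrite xiZ ep !scalerA mulrC.
have El : E@_l = 1 by rewrite mcoeffZ mulVf.
split.
  split; last exact/cherednik_eigenP.
  by apply: unitriangularP El => g; exact: (joint_eigen_support sep eE).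
move=> E' [/unitriangular_coeff E'l /cherednik_eigenP eE'].
apply/eqP; rewrite -subr_eq0; apply/eqP.
apply: (joint_eigen_coeff sep); last by rewrite mcoeffB El E'l subrr.
by move=> j; rewrite linearB /= eE eE' scalerBr.
Qed.

End Bridge.

(** * The formal parameter and the removal of poles *)

Section FormalParameter.
Variables (K : numFieldType) (N : nat).
Implicit Types (l g : 'X_{1..N}) (P : {mpoly {poly K}[N]}).

Lemma spec_formalE l j :
  spec 'X l j = (l j)%:R%:P * 'X - (rank l j)%:R%:P :> {poly K}.
Proof. by rewrite /spec mulrC !polyC_natr. Qed.

(** Unequal parts make the difference of degree one in alpha, so its square has degree two. *)
Lemma spec_formal_gen l k k' : l k != l k' ->
  (spec 'X l k - spec 'X l k' : {poly K}) ^+ 2 != 1.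
Proof.
move=> ne; rewrite !spec_formalE.
set d := _ - _; have dE : d = ((l k)%:R - (l k')%:R)%:P * 'X
    + ((rank l k')%:R - (rank l k)%:R)%:P by rewrite /d !polyCB; ring.
have sd : size d = 2.
  rewrite dE size_MXaddC polyC_eq0 subr_eq0 Num.Theory.eqr_nat (negbTE ne) /=.
  by rewrite size_polyC subr_eq0 Num.Theory.eqr_nat ne.
apply: contraTneq isT => e; have := size_exp d 2.
by rewrite e size_poly1 sd.
Qed.

(** The coefficient of alpha in each eigenvalue is the part itself. *)
Lemma separated_formal l : separated ('X : {poly K}) l.
Proof.
move=> g H; apply/mnmP => j; have /(congr1 (fun p : {poly K} => p`_1)) := H j.
rewrite !spec_formalE !coefB !coefMX !coefC /= !subr0.
by move/eqP; rewrite Num.Theory.eqr_nat => /eqP.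
Qed.

Lemma separated_formal_alpha l : separated (formal_alpha K) l.
Proof.
move=> g H; apply: separated_formal => j; apply/eqP; rewrite -tofrac_eq; apply/eqP.
by rewrite !map_spec H.
Qed.

(* Dividing out powers of 'X - a makes the specialisation at a nonzero. *)
Lemma joint_eigen_reduce (a : K) l P : P != 0 -> joint_eigen 'X l P ->
  exists2 Q : {mpoly {poly K}[N]}, joint_eigen 'X l Q & map_mpoly (horner_eval a) Q != 0.
Proof.
(* The coefficient of x^l is nonzero by separation over K[alpha], and each division lowers its
   degree; hence the process stops. *)
move: {2}(size P@_l) (leqnn (size P@_l)) => b.
elim: b P => [|b IH] P.
  rewrite leqn0 size_poly_eq0 => /eqP Pl Pnz eP.
  by rewrite (joint_eigen_coeff (@separated_formal l) eP Pl) eqxx in Pnz.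
move=> szP Pnz eP; have [P0|] := eqVneq (map_mpoly (horner_eval a) P) 0; last by exists P.
pose u : {poly K} := 'X - a%:P.
have unz : u != 0 by rewrite polyXsubC_eq0.
pose Q : {mpoly {poly K}[N]} := \sum_(g <- msupp P) (P@_g %/ u) *: 'X_[g].
have PQ : P = u *: Q.
  rewrite {1}[P]mpolyE /Q scaler_sumr; apply: eq_bigr => g _.
  rewrite scalerA mulrC divpK // dvdp_XsubCl rootE.
  by have /(congr1 (mcoeff g)) := P0; rewrite mcoeff_map_mpoly mcoeff0 => /eqP.
have Qnz : Q != 0 by apply: contraNneq Pnz => Q0; rewrite PQ Q0 scaler0.
have unz' : u%:MP_[N] != 0 by rewrite mpolyC_eq0.
have eQ : joint_eigen 'X l Q.
  move=> j; apply: (mulfI unz'); rewrite !mul_mpolyC -xiZ -PQ eP.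
  by rewrite {1}PQ !scalerA mulrC.
have Qlnz : Q@_l != 0.
  by apply: contraNneq Qnz => /(joint_eigen_coeff (@separated_formal l) eQ) ->.
apply: (IH Q) => //; move: szP; rewrite PQ mcoeffZ size_mul // size_XsubC /=.
by rewrite ltnS.
Qed.

End FormalParameter.

(** * Separation of the spectrum at -2/(r-1) *)

Section Arithmetic.
Variable N : nat.
Implicit Types (l g : 'X_{1..N}) (i j : 'I_N).

(** As ties go to the smaller index, raising the first [m] parts keeps the weak order along the
    ranks of [l], and [decr_rearr_rank] applies. *)
Lemma admissible_gap (r m : nat) l i j : weakly_admissible r m l ->
  rank l j = (rank l i).+1 -> (l j + r <= l i + (i < m))%N.
Proof.
move=> adm rij; have := adm (rank_ord l i) (rank_ord l j) rij.
rewrite /= decr_rearrE (@decr_rearr_rank _ l _ i) //.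
  by rewrite mnmE; lia.
by move=> u v; rewrite !mnmE /before; lia.
Qed.

Section Separation.
Variables (r m : nat) (l : 'X_{1..N}).
Hypothesis r1 : (1 < r)%N.
Hypothesis gap : forall i j, rank l j = (rank l i).+1 -> (l j + r <= l i + (i < m))%N.
Hypothesis decr : forall i j, (i < j)%N -> (j < m)%N -> (l j < l i)%N.

Lemma gap_iter d i j : rank l j = (rank l i + d)%N -> (l j + r.-1 * d <= l i)%N.
Proof.
elim: d j => [|d IH] j.
  by rewrite addn0 muln0 addn0 => /rank_inj ->.
rewrite addnS => e; have ltd : (rank l i + d < N)%N.
  by have := rank_ltN l j; rewrite e; lia.
have [k ek] := rank_surj l ltd; have := IH k ek.
by have := gap (etrans e (congr1 S (esym ek))); rewrite mulnS; lia.
Qed.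

(* The quantity 2 l_j + (r - 1) rank_j determines the spectrum at -2/(r - 1);
   g is recovered because consecutive ranks of g are increasing ranks of l. *)
Lemma spectrum_inj g :
  (forall j, 2 * g j + r.-1 * rank g j = 2 * l j + r.-1 * rank l j)%N -> g = l.
Proof.
move=> H.
have mono i j : rank g j = (rank g i).+1 -> (rank l i < rank l j)%N.
  move=> gij; have bij : before g i j by rewrite -rank_before gij.
  rewrite ltnNge leq_eqVlt negb_or; apply/andP; split.
    by apply: contraTneq bij => /rank_inj ->; rewrite before_irr.
  apply/negP => lji.
  (* The identities for [j] and [i] subtract to 2 (g_j - g_i) + (r-1) = 2 (l_j - l_i) - (r-1) d,
     which is at least (r-1) d; since g_j <= g_i, this forces d = 1. *)
  pose d := (rank l i - rank l j)%N.
  have rE : rank l i = (rank l j + d)%N by rewrite subnKC // ltnW.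
  have gi := gap_iter rE.
  have dpos : (0 < d)%N by rewrite subn_gt0.
  have Hi := H i; have Hj := H j; rewrite gij rE mulnS mulnDr in Hi Hj.
  have gle : (g j <= g i)%N by move: bij; rewrite /before; lia.
  have d1 : d = 1%N.
    apply/eqP; rewrite eqn_leq dpos andbT.
    have : (r.-1 * d <= r.-1 * 1)%N by rewrite muln1; lia.
    by rewrite leq_pmul2l //; lia.
  (* Now g_i = g_j and l_j - l_i = r - 1: the former gives i < j, the latter j < m, against
     [decr]. *)
  rewrite d1 !muln1 in gi Hi; rewrite d1 addn1 in rE.
  have := gap rE; have := @decr i j; move: bij; rewrite /before.
  by case: (ltnP j m); case: (ltnP i j) => /=; lia.
(* Strong induction on the rank in [l]. A smaller rank in [g] is already taken by another index; a
   larger one has a predecessor in [g] whose rank in [l] is below [s] by [mono], hence also its rank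
   in [g]. *)
suff rk s : forall j, rank l j = s -> rank g j = s.
  by apply/mnmP => j; have := H j; rewrite (rk _ j erefl); lia.
elim/ltn_ind: s => s IH j js; have [lt|gt|//] := ltngtP (rank g j) s.
  have ltN : (rank g j < N)%N by exact: rank_ltN.
  have [k ek] := rank_surj l ltN.
  by have /rank_inj e := IH _ lt k ek; rewrite e js in ek; rewrite -ek ltnn in lt.
have ltN : ((rank g j).-1 < N)%N by apply: leq_ltn_trans (rank_ltN g j); exact: leq_pred.
have [k ek] := rank_surj g ltN.
have kj : rank g j = (rank g k).+1 by rewrite ek prednK //; lia.
have := mono _ _ kj; rewrite js => lk.
by have := IH _ lk k erefl; lia.
Qed.

Lemma separated_alpha_1 (K : numFieldType) : separated (alpha_1 K r) l.
Proof.
move=> g H; apply: spectrum_inj => j; apply/eqP; rewrite -(Num.Theory.eqr_nat K).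
have := H j; rewrite /spec /alpha_1.
have rE : r%:R - 1 = r.-1%:R :> K by rewrite -[in LHS](prednK (ltnW r1)) -natr1 addrK.
have rnz : r.-1%:R != 0 :> K by rewrite Num.Theory.pnatr_eq0 -lt0n; lia.
rewrite rE !(natrD _ (2 * _)) !natrM => e; apply/eqP.
(* The quantity of [spectrum_inj] is the spectrum times -(r - 1). *)
have E (x y : K) : 2%:R * x + r.-1%:R * y = - r.-1%:R * (- 2 / r.-1%:R * x - y) by field.
by rewrite !E e.
Qed.

End Separation.
End Arithmetic.

(** * One eigenvector over K[alpha], read over K(alpha) and at [alpha_1] *)

Theorem mainTheorem7 (R : realType) (r m n : nat)
    (eta : m.-tuple nat) (mu : n.-tuple nat)
    (hr2 : (2 <= r)%N) (hr : ~~ odd r)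
    (heta : sorted gtn eta) (hmu : sorted geq mu)
    (hadm : weakly_admissible r m (concat_comp eta mu)) :
  exists E : {mpoly R[i][m + n]},
    nsJack_at (alpha_1 R[i] r) (concat_comp eta mu) E
    /\ unique
         (fun E' : {mpoly R[i][m + n]} =>
            unitriangular (concat_comp eta mu) E'
            /\ cherednik_eigen (alpha_1 R[i] r) (concat_comp eta mu) E')
         E.
Proof.
set l := concat_comp eta mu; set a := alpha_1 _ r.
have decr (i j : 'I_(m + n)) : (i < j)%N -> (j < m)%N -> (l j < l i)%N.
  move=> ij jm; rewrite !(mnm_nth 0%N) /= !nth_cat !size_tuple jm (ltn_trans ij jm).
  by apply: (sorted_ltn_nth (leT := gtn)); rewrite ?inE ?size_tuple ?(ltn_trans ij jm) //;
    move=> x y z /=; lia.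
have sep : separated a l.
  by apply: (@separated_alpha_1 _ r m) => // i j; exact: admissible_gap.
have [P Pnz eP] := exists_joint_eigen (@spec_formal_gen R[i] (m + n)) l.
have [Q eQ Qnz] := joint_eigen_reduce a Pnz eP.
set p := map_mpoly _ Q in Qnz.
have ep : joint_eigen a l p.
  by have := map_joint_eigen (horner_eval a) eQ; rewrite /= /horner_eval hornerX.
(* The normalising coefficient of [Q] does not vanish at [a], so dividing by it creates no pole. *)
have pl : p@_l != 0 by apply: contraNneq Qnz => /(joint_eigen_coeff sep ep) ->.
have plE : p@_l = (Q@_l).[a] by rewrite mcoeff_map_mpoly.
have Ql : Q@_l != 0 by apply: contraNneq pl => Q0; rewrite plE Q0 horner0.
pose q := map_mpoly (@FracField.tofrac {poly R[i]}) Q.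
have eq : joint_eigen (formal_alpha R[i]) l q by exact: map_joint_eigen.
have qE g : q@_g = FracField.tofrac Q@_g by exact: mcoeff_map_mpoly.
have ql : q@_l != 0 by rewrite qE tofrac_eq0.
exists ((p@_l)^-1 *: p); split; last exact: unique_nsJack.
exists ((q@_l)^-1 *: q); split.
  by apply: unique_nsJack => //; exact: separated_formal_alpha.
(* Numerator and denominator of each coefficient are the polynomial coefficients of [Q] itself. *)
move=> g; exists Q@_g, Q@_l; split; first by rewrite -plE.
  by rewrite mcoeffZ !qE mulrC.
by rewrite mcoeffZ mulrC plE mcoeff_map_mpoly.
Qed.
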